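(* Assume that every multigraph $H$ satisfies $\chi'(H)\le \max\{\Delta(H)+1,\ \lceil \Gamma(H)\rceil\}$. Then every multigraph $G$ satisfies $\xi(G)\ge \min\{\delta(G)-1,\ \lfloor \Phi(G)\rfloor\}$ if $\Phi(G)$ is not an integer, and $\xi(G)\ge \min\{\delta(G)-2,\ \lfloor \Phi(G)\rfloor-1\}$ if $\Phi(G)$ is an integer.
   Context: Multigraphs are finite, may have parallel edges, and have no loops. For a multigraph $G=(V,E)$: $\Delta(G)$ and $\delta(G)$ denote its maximum and minimum degree. The chromatic index $\chi'(G)$ is the least $k$ such that $E$ can be colored with $k$ colors so that each vertex is incident with at most one edge of each color. For $U\subseteq V$, $E(U)$ is the set of edges with both ends in $U$ and $E^+(U)$ is the set of edges with at least one end in $U$. The density is $\Gamma(G)=\max\{\frac{2|E(U)|}{|U|-1}: U\subseteq V,\ |U|\ge 3,\ |U| \text{ odd}\}$ and the co-density is $\Phi(G)=\min\{\frac{2|E^+(U)|}{|U|+1}: U\subseteq V,\ |U|\ge 3,\ |U| \text{ odd}\}$. The cover index $\xi(G)$ is the greatest integer $k$ such that $E$ can be colored with $k$ colors so that every vertex of $G$ is incident with at least one edge of each color (equivalently, the maximum number of pairwise disjoint edge covers of $G$, where an edge cover is a set of edges meeting every vertex). *)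

(* Defs.v *)
From HB Require Import structures.
From mathcomp Require Import all_boot all_order all_algebra.
From mathcomp Require Import constructive_ereal.

Set Implicit Arguments.
Unset Strict Implicit.
Unset Printing Implicit Defensive.

Import Order.TTheory GRing.Theory Num.Theory.

(* Edges are identified with elements of a finite type, so distinct edges may
   have the same pair of ends; the ends form a two-element set, so there are no
   loops.  As usual, a graph has at least one vertex (without this, neither the
   minimum degree nor the cover index would exist). *)
Record multigraph := Multigraph {
  vertex : finType;
  edge : finType;
  ends : edge -> {set vertex};
  card_ends : forall e, #|ends e| = 2;
  vertex_gt0 : 0 < #|vertex| }.

Section Invariants.
Variable G : multigraph.
Implicit Types (U : {set vertex G}) (v : vertex G) (k : nat).

Definition degree v : nat := #|[set e : edge G | v \in ends e]|.

Definition max_degree : nat := \max_(v : vertex G) degree v.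

(* Since there is a vertex and no degree exceeds the number of edges, the
   default value #|edge G| does not influence the minimum. *)
Definition min_degree : nat := \big[minn/#|edge G|]_(v : vertex G) degree v.

Definition edges_in U : {set edge G} := [set e | ends e \subset U].

Definition edges_touching U : {set edge G} := [set e | ends e :&: U != set0].

Definition odd_set U : bool := (3 <= #|U|) && odd #|U|.

(* All terms are nonnegative, so the default 0 matters only when there are
   fewer than three vertices. *)
Definition density : rat :=
  (\big[Num.max/0]_(U : {set vertex G} | odd_set U)
     ((2 * #|edges_in U|)%:R / (#|U|%:R - 1)))%R.

(* The minimum of the empty family (fewer than three vertices) is +oo. *)
Definition codensity : \bar rat :=
  \big[mine/+oo%E]_(U : {set vertex G} | odd_set U)
     ((2 * #|edges_touching U|)%:R / (#|U|%:R + 1))%R%:E.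

Definition edge_colorable k : bool :=
  [exists c : {ffun edge G -> 'I_k},
     [forall v, forall i, #|[set e | (v \in ends e) && (c e == i)]| <= 1]].

Lemma edge_colorable_ex : exists k, edge_colorable k.
Proof.
exists #|edge G|; apply/existsP; exists [ffun e => enum_rank e].
apply/forallP => v; apply/forallP => i.
rewrite -(cards1 (enum_val i)); apply: subset_leq_card; apply/subsetP => e.
by rewrite !inE ffunE => /andP[_ /eqP <-]; rewrite enum_rankK.
Qed.

Definition chromatic_index : nat := ex_minn edge_colorable_ex.

Definition cover_colorable k : bool :=
  [exists c : {ffun edge G -> 'I_k},
     [forall v, forall i, exists e, (v \in ends e) && (c e == i)]].

(* The bound k <= #|edge G| is no restriction, see cover_colorable_le.  The
   index is 0 when no k qualifies, i.e. when some vertex is isolated but there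
   are edges; this agrees with counting pairwise disjoint edge covers, see
   leq_cover_index. *)
Definition cover_index : nat :=
  \max_(k < #|edge G|.+1 | cover_colorable k) k.

Lemma cover_colorable_le k : cover_colorable k -> k <= #|edge G|.
Proof.
case/existsP => c /forallP cP.
have /card_gt0P[v _] := vertex_gt0 G.
rewrite -[leqLHS]card_ord.
have -> : #|'I_k| = #|[set c e | e in edge G]|.
  rewrite -cardsT; apply: eq_card => i; rewrite !inE; apply/esym/imsetP.
  have /existsP[e /andP[_ /eqP <-]] := forallP (cP v) i.
  by exists e.
exact: leq_imset_card.
Qed.

Lemma cover_index_max k : cover_colorable k -> k <= cover_index.
Proof.
move=> kP; have kE : k < #|edge G|.+1 by rewrite ltnS cover_colorable_le.
by rewrite /cover_index (bigD1 (Ordinal kE)) //= leq_maxl.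
Qed.

Lemma cover_index_colorable : 0 < cover_index -> cover_colorable cover_index.
Proof.
rewrite /cover_index; elim/big_ind: _ => // x y xP yP.
by rewrite /maxn; case: ifP.
Qed.

Definition edge_cover (F : {set edge G}) : bool :=
  [forall v, exists e in F, v \in ends e].

Lemma leq_cover_index k :
  k <= cover_index <->
  exists F : 'I_k -> {set edge G},
    (forall i, edge_cover (F i)) /\ (forall i j, i != j -> [disjoint F i & F j]).
Proof.
split.
- case: k => [|k]; first by exists (fun=> set0); split; case.
  move=> kx; have x0 : 0 < cover_index by exact: leq_ltn_trans kx.
  have /existsP[c /forallP cP] := cover_index_colorable x0.
  exists (fun i => [set e | c e == widen_ord kx i]); split.
    move=> i; apply/forallP => v.
    have /existsP[e /andP[ve ce]] := forallP (cP v) (widen_ord kx i).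
    by apply/existsP; exists e; rewrite inE ce.
  move=> i j; apply: contraNT => /pred0Pn[e /andP[]]; rewrite !inE => /eqP ->.
  by move=> /eqP[ij]; apply/eqP/val_inj.
- case: k => [//|k] [F [Fc Fd]]; apply: cover_index_max.
  apply/existsP; exists [ffun e => odflt ord0 [pick i | e \in F i]].
  apply/forallP => v; apply/forallP => i.
  have /existsP[e /andP[eF ve]] := forallP (Fc i) v.
  apply/existsP; exists e; rewrite ve ffunE /=.
  case: pickP => [j ejF|/(_ i)]; last by rewrite eF.
  apply/negPn/negP => /= ji; have /pred0P/(_ e) := Fd _ _ ji.
  by rewrite /= ejF eF.
Qed.

End Invariants.

(* Main.v *)
Require Import Defs.
From mathcomp Require Import all_boot all_order all_algebra.
From mathcomp Require Import constructive_ereal.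
From mathcomp Require Import zify.
Import Order.TTheory GRing.Theory Num.Theory.

Set Implicit Arguments.
Unset Strict Implicit.
Unset Printing Implicit Defensive.

(** Suppose every degree exceeds k and 2|E^+(U)| > k(|U|+1) for all odd U with
    |U| >= 3.  Edges can be detached from their ends, one end at a time, until
    every vertex keeps exactly k+1 edges while the inequality survives; for a
    singleton U the inequality says that the degree exceeds k, so the two
    hypotheses are preserved as one.  Letting the detached ends become pendant
    vertices gives a multigraph of maximum degree at most k+1 and, by parity,
    of density at most k+2, hence edge-colorable with k+2 colors.  Each original
    vertex then misses exactly one color.  The last two color classes form
    paths and even cycles; orienting them lets every vertex that misses one of
    the first k colors own an edge of the last two classes, and that edge is
    recolored with the missing color. *)

(** * Counting the edges covered by a vertex set *)

Section SetFamily.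
Variables V E : finType.
Implicit Types (D : V -> {set E}) (U W : {set V}) (e : E) (k : nat).

(* An edge e of a multigraph is kept at the ends v with e in D v; the family D
   records a partially detached multigraph. *)
Definition holders D e : {set V} := [set v | e \in D v].

Definition covered D U : {set E} := \bigcup_(v in U) D v.

Lemma in_covered D U e : (e \in covered D U) = (0 < #|holders D e :&: U|).
Proof.
apply/bigcupP/card_gt0P => [[v vU eD]|[v]]; last first.
  by rewrite !inE => /andP[]; exists v.
by exists v; rewrite !inE eD.
Qed.

Lemma card_sum_mem (T : finType) (A : {set T}) : #|A| = \sum_(x : T) (x \in A).
Proof. by rewrite -sum1_card big_mkcond; apply: eq_bigr => x _; case: ifP. Qed.

Lemma sum_card_holders D U :
  \sum_(v in U) #|D v| = \sum_e #|holders D e :&: U|.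
Proof.
under eq_bigr => v _ do rewrite card_sum_mem.
rewrite exchange_big; apply: eq_bigr => e _.
rewrite card_sum_mem big_mkcond; apply: eq_bigr => v _.
by rewrite !inE; case: (v \in U); rewrite ?andbT ?andbF.
Qed.

Lemma covered_submod D U W :
  #|covered D (U :|: W)| + #|covered D (U :&: W)|
    <= #|covered D U| + #|covered D W|.
Proof.
rewrite -[leqRHS]cardsUI /covered bigcup_setU leq_add2l subset_leq_card //.
apply/bigcupsP => v; rewrite inE => /andP[vU vW].
by rewrite subsetI !bigcup_sup.
Qed.

(** Checked edge by edge: an edge with [a > 0] holders in [U :&: W] counts twice on the right and
    meets at most [2 - a] of the two differences; for [a = 0] both sides agree. *)
Lemma covered_posimod D U W : (forall e, #|holders D e| <= 2) ->
  #|covered D (U :\: W)| + #|covered D (W :\: U)| + \sum_(v in U :&: W) #|D v|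
    <= #|covered D U| + #|covered D W|.
Proof.
move=> D2; rewrite sum_card_holders !card_sum_mem -!big_split; apply: leq_sum => e _.
rewrite /= !in_covered; set S := holders D e.
have SU : #|S :&: U| = #|S :&: (U :&: W)| + #|S :&: (U :\: W)|.
  by rewrite -(cardsID W (S :&: U)) setIDA setIA.
have SW : #|S :&: W| = #|S :&: (U :&: W)| + #|S :&: (W :\: U)|.
  by rewrite -(cardsID U (S :&: W)) setIDA -setIA [W :&: U]setIC.
have : #|S :&: U| + #|S :&: (W :\: U)| <= 2.
  apply: leq_trans (D2 e); rewrite -(cardsID U S) leq_add2l subset_leq_card //.
  by rewrite setIDA setSD // subsetIl.
by rewrite -/S SU SW; lia.
Qed.

Lemma sum_card_covered D U : (forall e, #|holders D e| <= 2) ->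
  \sum_(v in U) #|D v|
    = #|covered D U| + #|[set e | 1 < #|holders D e :&: U|]|.
Proof.
move=> D2; rewrite sum_card_holders !card_sum_mem -big_split; apply: eq_bigr => e _.
rewrite /= in_covered inE.
have := leq_trans (subset_leq_card (subsetIl (holders D e) U)) (D2 e).
by lia.
Qed.

(* For odd |U| this is 2|covered D U| > k(|U|+1), both sides being even. *)
Definition cosparse k D : Prop :=
  forall U, odd #|U| -> k * uphalf #|U| < #|covered D U|.

Lemma cosparse_card k D v : cosparse k D -> k < #|D v|.
Proof.
by move/(_ [set v]); rewrite cards1 muln1 /covered big_set1 => ->.
Qed.

(** * Detaching one end at a time *)

Definition remove D u e v : {set E} := if v == u then D v :\ e else D v.

Lemma cosparse_remove k D u :
    (forall e, #|holders D e| <= 2) -> cosparse k D -> k.+1 < #|D u| ->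
  exists2 e, e \in D u & cosparse k (remove D u e).
Proof.
move=> D2 Dk ku.
pose tight U := [&& odd #|U|, u \in U & #|covered D U| == (k * uphalf #|U|).+1].
(* Detaching can lose no covered edge but [e], so the inequality fails only at a tight set in which
   no other vertex holds [e]. *)
have tightP e U : odd #|U| -> #|covered (remove D u e) U| <= k * uphalf #|U| ->
    tight U /\ {in U, forall v, v != u -> e \notin D v}.
  move=> oU leU; have ltU := Dk U oU.
  have sub : covered D U :\ e \subset covered (remove D u e) U.
    apply/subsetP => x /setD1P[xe /bigcupP[v vU xv]]; apply/bigcupP; exists v => //.
    by rewrite /remove; case: eqP; rewrite // inE inE xe xv.
  have := subset_leq_card sub; have := cardsD1 e (covered D U).
  move=> cD le1; rewrite /tight oU /=.
  have nsub : ~~ (covered D U \subset covered (remove D u e) U).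
    by apply/negP => /subset_leq_card; lia.
  split.
    apply/andP; split; last by apply/eqP; lia.
    apply: contraR nsub => uU; apply/bigcupsP => v vU.
    have -> : D v = remove D u e v.
      by rewrite /remove; case: eqP => // vu; rewrite -vu vU in uU.
    exact: bigcup_sup.
  move=> v vU vu; apply: contra nsub => ev.
  apply/subsetP => x xU; case: (eqVneq x e) => [->|xe].
    by apply/bigcupP; exists v; rewrite // /remove (negPf vu).
  by apply: (subsetP sub); rewrite inE inE xe.
case: (pickP tight) => [T0 tT0|notight]; last first.
  have /card_gt0P[e eu] : 0 < #|D u| by lia.
  exists e => // U oU; rewrite ltnNge; apply/negP => /(tightP _ _ oU)[].
  by rewrite notight.
(* Tight sets are closed under intersection, so T lies in all of them, and an
   edge of u with another end in T can be removed. *)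
case: (arg_minnP (fun T : {set V} => #|T|) tT0) => T /and3P[oT uT /eqP cT] Tmin.
have Tsub W : tight W -> T \subset W.
  move=> tW; case/and3P: (tW) => oW uW /eqP cW.
  suff tI : tight (T :&: W).
    by apply/setIidPl/eqP; rewrite eqEcard subsetIl Tmin.
  have cTW := cardsID W T; have cWT := cardsID T W; rewrite setIC in cWT.
  have uTW : u \in T :&: W by rewrite inE uT.
  have [oI|eI] := boolP (odd #|T :&: W|).
    (* Odd case: the union is odd too, and submodularity leaves no slack, so the intersection is
       tight. *)
    have oUn : odd #|T :|: W| by have := cardsUI T W; lia.
    have := covered_submod D T W; have := Dk _ oI; have := Dk _ oUn.
    rewrite cT cW /tight oI uTW /=.
    have -> : uphalf #|T :|: W| = uphalf #|T| + uphalf #|W| - uphalf #|T :&: W|.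
      by have := cardsUI T W; lia.
    have : uphalf #|T :&: W| <= uphalf #|T| by lia.
    by move=> h; rewrite mulnBr mulnDr; have := leq_mul (leqnn k) h; lia.
  (* Even case, contradictory: both differences are odd, and each vertex of the nonempty
     intersection adds at least [k.+1], more than posimodularity allows. *)
  have oTW : odd #|T :\: W| by lia.
  have oWT : odd #|W :\: T| by lia.
  have := covered_posimod T W D2; have := Dk _ oTW; have := Dk _ oWT.
  have : #|T :&: W| * k.+1 <= \sum_(v in T :&: W) #|D v|.
    by rewrite -sum_nat_const; apply: leq_sum => v _; apply: cosparse_card.
  have : 0 < #|T :&: W| by apply/card_gt0P; exists u.
  have -> : uphalf #|T :\: W| = uphalf #|T| - #|T :&: W|./2 by lia.
  have -> : uphalf #|W :\: T| = uphalf #|W| - #|T :&: W|./2 by lia.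
  have : #|T :&: W| = #|T :&: W|./2 + #|T :&: W|./2 by lia.
  rewrite !mulnBr cT cW mulnS; move: (#|T :&: W|./2) => h ->.
  by rewrite mulnDl ![h * k]mulnC; lia.
(* Otherwise [u] adds at least [k.+2] edges to those covered by [T :\ u]. Dropping a further vertex
   [w] leaves an odd set, so [T] covers too many edges to be tight. *)
have [v /andP[vT vu] /pred0Pn[e /andP[/= eu ev]]] :
    exists2 v, (v \in T) && (v != u) & ~~ [disjoint D u & D v].
  apply/exists_inP; apply: contraT; rewrite negb_exists_in => /forall_inP dis.
  have cT1 := cardsD1 u T; rewrite uT in cT1.
  have [w wTu] : exists w, w \in T :\ u.
    apply/card_gt0P; rewrite lt0n; apply/eqP => T1.
    have /eqP : T :\ u == set0 by rewrite -cards_eq0 T1.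
    move=> Tu0; move: cT; rewrite -(setD1K uT) Tu0 setU0 cards1 muln1.
    by rewrite /covered big_set1; lia.
  have cT2 := cardsD1 w (T :\ u); rewrite wTu in cT2.
  have oT2 : odd #|T :\ u :\ w| by lia.
  have dcov : [disjoint D u & covered D (T :\ u)].
    apply/bigcup_disjointP => x; rewrite inE inE => /andP[xu xT].
    by have := dis x; rewrite xT xu negbK => ->.
  have cTE : #|covered D T| = #|D u| + #|covered D (T :\ u)|.
    have /setP eqT : covered D T = D u :|: covered D (T :\ u).
      by rewrite /covered (big_setD1 u).
    by rewrite (eq_card eqT) cardsU (disjoint_setI0 dcov) cards0 subn0.
  have := Dk _ oT2; have : #|covered D (T :\ u :\ w)| <= #|covered D (T :\ u)|.
    apply: subset_leq_card; apply/bigcupsP => x /setD1P[_ xT].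
    exact: bigcup_sup.
  have -> : uphalf #|T :\ u :\ w| = (uphalf #|T|).-1 by lia.
  have : 0 < uphalf #|T| by lia.
  by move: cT; rewrite cTE; case: uphalf => // n; rewrite mulnS /=; lia.
exists e => // U oU; rewrite ltnNge; apply/negP => /(tightP _ _ oU)[tU].
by move=> /(_ _ (subsetP (Tsub _ tU) _ vT) vu); rewrite ev.
Qed.

Lemma cosparse_sub k D : (forall e, #|holders D e| <= 2) -> cosparse k D ->
  exists D', [/\ forall v, D' v \subset D v, forall v, #|D' v| = k.+1
               & cosparse k D'].
Proof.
have [n] := ubnP (\sum_v #|D v|); elim: n D => // n IHn D lenD D2 Dk.
have [/forallP Deq|] := boolP [forall v, #|D v| == k.+1].
  by exists D; split=> // v; apply/eqP.
rewrite negb_forall => /existsP[u neu].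
have ku : k.+1 < #|D u| by have := cosparse_card u Dk; lia.
have [e eu Dek] := cosparse_remove D2 Dk ku.
have sub v : remove D u e v \subset D v.
  by rewrite /remove; case: eqP => // _; apply: subsetDl.
have [||//|D' [D'sub D'k Dk']] := IHn (remove D u e).
- rewrite (bigD1 u) //= [X in _ + X](eq_bigr (fun v => #|D v|)); last first.
    by move=> v /negPf vu; rewrite /remove vu.
  move: lenD; rewrite (bigD1 u) //= /remove eqxx (cardsD1 e (D u)) eu.
  by lia.
- move=> x; apply: leq_trans (D2 x); apply: subset_leq_card.
  by apply/subsetP => v; rewrite !inE; apply/subsetP.
by exists D'; split=> // v; apply: subset_trans (sub v).
Qed.

(** A system of distinct representatives: [o] is a function, so different vertices own different
    edges. It stands for the orientation of the paths and cycles. *)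
Lemma exists_owner D (X : {set V}) :
    (forall e, #|holders D e| <= 2) -> {in X, forall x, 1 < #|D x|} ->
  exists o : E -> option V,
    {in X, forall x, exists2 e, e \in D x & o e = Some x}.
Proof.
(* One vertex may have a single edge: after x0 takes e, the other holder of e
   plays the role of x0. *)
suff gen (n : nat) : forall D (X : {set V}) x0, #|X| = n -> x0 \in X ->
      (forall e, #|holders D e :&: X| <= 2) -> 0 < #|D x0| ->
      {in X, forall x, x != x0 -> 1 < #|D x|} ->
    exists o : E -> option V, {in X, forall x, exists2 e, e \in D x & o e = Some x}.
  move=> D2 DX; have [->|[x0 x0X]] := set_0Vmem X.
    by exists (fun=> None) => x; rewrite inE.
  apply: (gen _ D X x0) => // [e||x xX _]; last exact: DX.
    exact: leq_trans (subset_leq_card (subsetIl _ _)) (D2 e).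
  exact: ltnW (DX _ x0X).
elim: n => [|n IHn] {}D {}X x0 cX x0X D2 /card_gt0P[e ex0] DX.
  by move/eqP: cX; rewrite cards_eq0 => /eqP X0; rewrite X0 inE in x0X.
have cX1 : #|X :\ x0| = n by have := cardsD1 x0 X; rewrite x0X; lia.
suff [o' o'P] : exists o : E -> option V,
    {in X :\ x0, forall x, exists2 y, y \in D x :\ e & o y = Some x}.
  exists (fun y => if y == e then Some x0 else o' y) => x xX.
  have [->|xx0] := eqVneq x x0; first by exists e; rewrite ?eqxx.
  have [|y /setD1P[ye yx] oy] := o'P x; first by rewrite inE inE xx0.
  by exists y => //; rewrite (negPf ye).
have sub2 y : #|holders (fun v => D v :\ e) y :&: (X :\ x0)| <= 2.
  apply: leq_trans (D2 y); apply: subset_leq_card.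
  by apply/subsetP => v; rewrite !inE => /andP[/andP[_ ->] /andP[_ ->]].
pose Z := holders D e :&: (X :\ x0).
have Z1 : #|Z| <= 1.
  have := D2 e; rewrite (cardsD1 x0) !inE ex0 x0X /= add1n ltnS.
  apply: leq_trans; apply: subset_leq_card.
  by apply/subsetP => v; rewrite !inE => /and3P[-> -> ->].
have cDe x : x \in X :\ x0 -> x \notin Z -> #|D x :\ e| = #|D x|.
  move=> xX; rewrite inE xX andbT inE => ex.
  by have := cardsD1 e (D x); rewrite (negPf ex).
have [X0|[x1 x1X]] := set_0Vmem (X :\ x0).
  by exists (fun=> None) => x; rewrite X0 inE.
have DX' x : x \in X :\ x0 -> 1 < #|D x|.
  by case/setD1P => xx0 xX; apply: DX.
(* [x2] is the other holder of [e] in [X] if there is one, else arbitrary; only [x2] may be left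
   with a single edge. *)
have [x2 [x2X Z2]] : exists x2, x2 \in X :\ x0 /\ Z \subset [set x2].
  have [Z0|[x2 x2Z]] := set_0Vmem Z; first by exists x1; rewrite Z0 sub0set.
  exists x2; split; first by case/setIP: x2Z.
  by apply/subsetP => y yZ; rewrite inE; apply/eqP/(card_le1_eqP Z1).
apply: (IHn _ _ x2) => //.
  by have := cardsD1 e (D x2); have := DX' _ x2X; lia.
move=> x xX xx2; rewrite cDe ?DX' //.
by apply: contra xx2 => /(subsetP Z2); rewrite inE.
Qed.

End SetFamily.

(** * The multigraph whose detached ends are pendant vertices *)

Section Detach.
Variables (G : multigraph) (D : vertex G -> {set edge G}).

(** Every pair [(e, v)] is available as a new vertex, so each detached end has its own; the
    remaining pairs become isolated vertices. *)
Definition detached_end (e : edge G) (v : vertex G) :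
    (vertex G + edge G * vertex G)%type :=
  if e \in D v then inl v else inr (e, v).

Lemma detached_end_inj e : injective (detached_end e).
Proof. by move=> v w; rewrite /detached_end; do 2!case: ifP => _; case. Qed.

Definition detached_ends e := detached_end e @: ends e.

Lemma card_detached_ends e : #|detached_ends e| = 2.
Proof. by rewrite card_imset ?card_ends //; apply: detached_end_inj. Qed.

Lemma detached_vertex_gt0 : 0 < #|{: vertex G + edge G * vertex G}|.
Proof. by rewrite card_sum ltn_addr ?vertex_gt0. Qed.

Definition detach : multigraph :=
  Multigraph card_detached_ends detached_vertex_gt0.

Hypothesis D_ends : forall v e, e \in D v -> v \in ends e.

Lemma card_holders_ends e : #|holders D e| <= 2.
Proof.
rewrite -(card_ends e) subset_leq_card //; apply/subsetP => v.
by rewrite inE; apply: D_ends.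
Qed.

Lemma mem_detached_ends_inl e v : (inl v \in detached_ends e) = (e \in D v).
Proof.
apply/imsetP/idP => [[w _]|eD].
  by rewrite /detached_end; case: ifP => // ew [->].
by exists v; [apply: D_ends | rewrite /detached_end eD].
Qed.

Lemma mem_detached_ends_inr e p : inr p \in detached_ends e -> e = p.1.
Proof.
by case/imsetP => w _; rewrite /detached_end; case: ifP => // ew [->].
Qed.

Variable k : nat.
Hypotheses (D_card : forall v, #|D v| = k.+1) (D_cosparse : cosparse k D).

Lemma max_degree_detach : max_degree detach <= k.+1.
Proof.
apply/bigmax_leqP => -[v|p] _.
  rewrite -(D_card v) subset_leq_card //; apply/subsetP => e.
  by rewrite inE /= mem_detached_ends_inl.
apply: (@leq_trans #|[set p.1]|); last by rewrite cards1.
apply: subset_leq_card; by apply/subsetP => e; rewrite !inE /= => /mem_detached_ends_inr ->.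
Qed.

(** The density bound without denominators. [U] splits into original vertices [W] and new vertices
    [P]; the parity of [#|W|] decides which count applies. *)
Lemma card_edges_in_detach (U : {set vertex detach}) : odd_set U ->
  2 * #|edges_in U| <= k.+2 * #|U|.-1.
Proof.
case/andP => U3 oU.
pose W : {set vertex G} := [set v | inl v \in U].
pose P : {set edge G * vertex G} := [set p | inr p \in U].
have cU : #|U| = #|W| + #|P|.
  have -> : U = inl @: W :|: inr @: P.
    apply/setP => x; rewrite inE; case: x => [v|p].
      rewrite mem_imset => [|? ? []//]; rewrite inE orbC.
      by case: imsetP => // -[].
    rewrite orbC mem_imset => [|? ? []//]; rewrite inE orbC.
    by case: imsetP => // -[].
  rewrite cardsU !card_imset => [|? ? []|? ? []] //.
  rewrite (_ : _ :&: _ = set0) ?cards0 ?subn0 //; apply/setP => x.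
  by rewrite !inE; apply/negbTE/andP => -[/imsetP[v _ ->] /imsetP[]].
pose Pe e : {set vertex G} := [set v | (e, v) \in P].
have cP : #|P| = \sum_e #|Pe e|.
  under [RHS]eq_bigr => e _ do rewrite card_sum_mem.
  rewrite card_sum_mem pair_bigA; apply: eq_bigr => -[e v] _.
  by rewrite [in RHS]inE.
have Fe e : e \in edges_in U -> 2 <= #|holders D e :&: W| + #|Pe e|.
  rewrite inE => /subsetP sU; rewrite -(@card_ends G e).
  apply: leq_trans (leq_card_setU (holders D e :&: W) (Pe e)).
  apply: subset_leq_card; apply/subsetP => v ve; have := sU _ (imset_f (detached_end e) ve).
  by rewrite !inE /detached_end; case: ifP => _ ->; rewrite ?orbT.
have sW : \sum_(v in W) #|D v| = #|W| * k.+1.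
  by rewrite -sum_nat_const; apply: eq_bigr => v _; apply: D_card.
have [oW|eW] := boolP (odd #|W|).
  (* Odd case: an edge inside [U] has two holders in [W] or uses a vertex of [P]. Cosparsity and the
     degree sum bound the former by [k.+2 * #|W|./2]. *)
  have le1 : #|edges_in U| <= #|[set e | 1 < #|holders D e :&: W|]| + #|P|.
    rewrite cP !card_sum_mem -big_split; apply: leq_sum => e _ /=.
    case: (boolP (e \in edges_in U)) => // /Fe.
    by rewrite inE; lia.
  have := sum_card_covered W card_holders_ends; rewrite sW.
  have := D_cosparse oW; move: le1; rewrite cU.
  have [m ->] : exists m, #|W| = m.*2.+1 by exists #|W|./2; lia.
  rewrite /= doubleK; nia.
(* Even case: the degree sum suffices, since [#|P|] is odd, hence positive, which makes up for the
   predecessor in [#|U|.-1]. *)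
have le2 : 2 * #|edges_in U| <= \sum_(v in W) #|D v| + #|P|.
  rewrite cP sum_card_holders card_sum_mem -big_split big_distrr.
  apply: leq_sum => e _ /=.
  case: (boolP (e \in edges_in U)) => // /Fe.
  by rewrite muln1.
rewrite sW cU in le2 *.
have : 0 < #|P| by lia.
move: le2; nia.
Qed.

Lemma density_detach : (density detach <= k.+2%:R)%R.
Proof.
apply: bigmax_le => [|U oU]; first exact: ler0n.
have /andP[U3 _] := oU.
rewrite ler_pdivrMr ?subr_gt0 ?ltr1n; last by lia.
rewrite -[X in (_ - X)%R]/(1%:R)%R -natrB; last by lia.
by rewrite -natrM ler_nat subn1 card_edges_in_detach.
Qed.

End Detach.

(** * From edge colorings to cover colorings *)

Lemma edge_colorableW (G : multigraph) m n :
  m <= n -> edge_colorable G m -> edge_colorable G n.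
Proof.
move=> mn /existsP[c /forallP cP]; apply/existsP.
exists [ffun e => widen_ord mn (c e)].
apply/forallP => v; apply/forallP => i.
apply/card_le1_eqP => e f; rewrite !inE !ffunE => /andP[ve /eqP ei] /andP[vf /eqP fi].
have /card_le1_eqP := forallP (cP v) (c e); apply; rewrite !inE ?ve ?vf ?eqxx //=.
by apply/eqP/val_inj; move: (etrans fi (esym ei)) => /(congr1 val).
Qed.

(** The number of covers is written [k.+1] so that ['I_k.+1] is inhabited. Colors up to [k] are
    kept; edges colored [k.+1] or [k.+2] are recolored. *)
Lemma cover_colorable_detach (G : multigraph) (D : vertex G -> {set edge G}) k :
    (forall v e, e \in D v -> v \in ends e) -> (forall v, #|D v| = k.+2) ->
  edge_colorable (detach D) k.+3 -> cover_colorable G k.+1.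
Proof.
move=> De Dk /existsP[c /forallP cP].
have cinj v : {in D v &, injective c}.
  move=> e f ev fv ef; have /card_le1_eqP := forallP (cP (inl v)) (c e).
  by apply; rewrite !inE /= mem_detached_ends_inl // ?ev ?fv ?ef eqxx.
have /fin_all_exists[miss missP] v : exists i, ~: (c @: D v) = [set i].
  apply/cards1P; have := cardsC (c @: D v).
  by rewrite (card_in_imset (@cinj v)) Dk card_ord; lia.
have hasc v i : i != miss v -> exists2 e, e \in D v & c e = i.
  move=> iv; have : i \in c @: D v.
    by rewrite -[_ @: _]setCK missP !inE.
  by case/imsetP => e; exists e.
pose X := [set v | miss v <= k].
pose N v := [set e in D v | k < c e].
(* Only one color is missing at [v], so a vertex of [X] sees both of the last two colors. *)
have NX : {in X, forall v, 1 < #|N v|}.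
  move=> v; rewrite inE => vk.
  have lt1 : k.+1 < k.+3 by []. 
  have lt2 : k.+2 < k.+3 by [].
  have [|e eD ce] := hasc v (Ordinal lt1).
    by rewrite -val_eqE /=; lia.
  have [|f fD cf] := hasc v (Ordinal lt2).
    by rewrite -val_eqE /=; lia.
  apply/card_gt1P; exists e, f; split; rewrite ?inE ?eD ?fD ?ce ?cf //=.
  by apply/eqP => ef; move: ce; rewrite ef cf => /(congr1 val) /=; lia.
have [|o oP] := exists_owner _ NX.
  move=> e; apply: leq_trans (card_holders_ends De e); apply: subset_leq_card.
  by apply/subsetP => v; rewrite !inE => /andP[].
apply/existsP.
(* An unowned edge of the last two classes gets the arbitrary color [ord0]: additional edges never
   spoil a cover. *)
exists [ffun e => if c e <= k then inord (c e)
                  else if o e is Some v then inord (miss v) else ord0].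
apply/forallP => v; apply/forallP => i.
have ik : i <= k by rewrite -ltnS.
pose i' : 'I_k.+3 := widen_ord (leq_addl 2 k.+1) i.
have [mi|mi] := eqVneq i' (miss v).
  have [|e] := oP v; first by rewrite inE -mi.
  rewrite inE => /andP[eD ce] oe; apply/existsP; exists e.
  by rewrite (De _ _ eD) ffunE leqNgt ce /= oe -mi; apply/eqP/val_inj; rewrite /= inordK.
have [e eD ce] := hasc v i' mi; apply/existsP; exists e.
by rewrite (De _ _ eD) ffunE ce /= ik; apply/eqP/val_inj; rewrite /= inordK.
Qed.

(** * Applying the assumed bound on the chromatic index *)

Definition chromatic_index_bound : Prop :=
  forall H : multigraph,
    ((chromatic_index H)%:Z
       <= Num.max ((max_degree H)%:Z + 1) (Num.ceil (density H)))%R.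

Lemma cover_index_ge (G : multigraph) k : chromatic_index_bound ->
    (forall v : vertex G, k < degree v) ->
    (forall U : {set vertex G}, odd_set U ->
       k * #|U|.+1 < 2 * #|edges_touching U|) ->
  k <= cover_index G.
Proof.
case: k => // k bound degk touchk.
pose D (v : vertex G) := [set e : edge G | v \in ends e].
have De v e : e \in D v -> v \in ends e by rewrite inE.
have D2 := card_holders_ends De.
have Dk : cosparse k.+1 D.
  move=> U oU; have [U3|U3] := leqP 3 #|U|.
    have <- : edges_touching U = covered D U.
      apply/setP => e; rewrite in_covered inE card_gt0; congr (_ :&: _ != _).
      by apply/setP => v; rewrite !inE.
    have := touchk U; rewrite /odd_set U3 oU => /(_ isT).
    have [m ->] : exists m, #|U| = m.*2.+1 by exists #|U|./2; lia.
    by rewrite /= doubleK; nia.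
  have /cards1P[v ->] : #|U| == 1 by move: oU U3; case: #|U| => [|[|[]]].
  by rewrite cards1 muln1 /covered big_set1 degk.
have [D' [D'sub D'k Dk']] := cosparse_sub D2 Dk.
have De' v e : e \in D' v -> v \in ends e by move/(subsetP (D'sub v))/De.
apply/cover_index_max/(cover_colorable_detach De' D'k).
have chi : edge_colorable (detach D') (chromatic_index (detach D')).
  by rewrite /chromatic_index; case: ex_minnP.
apply: edge_colorableW chi.
(* The detached multigraph has maximum degree at most [k.+2] and density at most [k.+3], so [k.+3]
   colors suffice. *)
rewrite -lez_nat; apply: le_trans (bound _) _; rewrite ge_max; apply/andP; split.
  by have := max_degree_detach De' D'k; lia.
by rewrite ceil_le_int density_detach.
Qed.

Lemma min_degree_le (G : multigraph) (v : vertex G) : min_degree G <= degree v.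
Proof. by rewrite /min_degree -minEnat -leEnat bigmin_le. Qed.

Lemma codensity_gt (G : multigraph) k (U : {set vertex G}) :
    ((k%:R)%:E < codensity G)%E -> odd_set U ->
  k * #|U|.+1 < 2 * #|edges_touching U|.
Proof.
move=> kG oU; have := lt_le_trans kG (bigmin_le_cond _ _ oU).
by rewrite lte_fin natr1 ltr_pdivlMr ?ltr0n // -natrM ltr_nat.
Qed.

(** Both cases reduce to this strict form: a non-integral co-density exceeds its floor, an integral
    one has to be lowered by one. *)
Lemma int_le_cover_index (G : multigraph) (z : int) : chromatic_index_bound ->
    (z < (min_degree G)%:Z)%R -> ((z%:~R)%:E < codensity G)%E ->
  (z <= (cover_index G)%:Z)%R.
Proof.
case: z => // k bound kdeg kG; rewrite lez_nat; apply: cover_index_ge => //.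
  by move=> v; apply: leq_trans (min_degree_le v); rewrite -ltz_nat.
by move=> U; apply: codensity_gt.
Qed.

Theorem theorem1 :
  (forall H : multigraph,
     ((chromatic_index H)%:Z
        <= Num.max ((max_degree H)%:Z + 1) (Num.ceil (density H)))%R) ->
  forall G : multigraph,
    ((~ exists m : int, codensity G = (m%:~R)%R%:E) ->
       (mine ((min_degree G)%:Z - 1)%R%:E (er_map Num.floor (codensity G))
          <= ((cover_index G)%:Z)%:E)%E)
    /\
    ((exists m : int, codensity G = (m%:~R)%R%:E) ->
       (mine ((min_degree G)%:Z - 2)%R%:E
             (er_map Num.floor (codensity G) - 1%R%:E)
          <= ((cover_index G)%:Z)%:E)%E).
Proof.
move=> bound G; split; last first.
  case=> m Gm; rewrite Gm /= intrKfloor -EFin_min lee_fin.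
  apply: int_le_cover_index => //; first by lia.
  by rewrite Gm lte_fin ltr_int; lia.
case GE : (codensity G) => [r||] nint /=.
- rewrite -EFin_min lee_fin; apply: int_le_cover_index => //; first by lia.
  rewrite GE lte_fin; apply: (@le_lt_trans _ _ (Num.floor r)%:~R%R).
    by rewrite ler_int ge_min lexx orbT.
  rewrite lt_neqAle floor_le andbT; apply/eqP => rE; apply: nint.
  by exists (Num.floor r); rewrite rE.
(* With fewer than three vertices the co-density is infinite and the degree term is the minimum. *)
- rewrite ge_min; apply/orP; left; rewrite lee_fin.
  by apply: int_le_cover_index => //; [lia | rewrite GE ltry].
- by rewrite ge_min leNye orbT.
Qed.
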